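(* Let $\rho:\mathbb{R}\to\mathbb{R}$ be a non-negative convex function, let $\kappa_*\in(0,1)$, let $W$ be a real random variable with law $P_\epsilon$ (mean $0$, variance $\sigma_*^2<\infty$), and let $Z\sim\mathcal N(0,1)$ be independent of $W$. Consider the following three systems of equations. (LOO) In the unknowns $(\tau_1,\lambda_1)$, $\tau_1,\lambda_1>0$: $$1-\kappa_*=\mathbb E\Big[\frac{\partial \mathrm{Prox}_\rho}{\partial x}(W+\tau_1 Z;\lambda_1)\Big],\qquad \kappa_*\tau_1^2=\mathbb E\Big[\big(W+\tau_1 Z-\mathrm{Prox}_\rho(W+\tau_1 Z;\lambda_1)\big)^2\Big].$$ (AMP) In the unknowns $(\tau_2,\lambda_2)$, $\tau_2,\lambda_2>0$: $$\tau_2^2=\frac{1}{\kappa_*}\lambda_2^2\,\mathbb E\Big[\Big(\frac{\partial M_\rho}{\partial x}(W+\tau_2 Z;\lambda_2)\Big)^2\Big],\qquad \kappa_*=\lambda_2\,\mathbb E\Big[\frac{\partial^2 M_\rho}{\partial x^2}(W+\tau_2 Z;\lambda_2)\Big].$$ (CGMT) In the unknowns $(\tau_3,\alpha,\mu)$, $\tau_3,\alpha,\mu>0$: $$0=\frac{\alpha}{2}-\tau_3\sqrt{\kappa_*}-\frac{\alpha}{\mu^2}\mathbb E\Big[\frac{\partial M_\rho}{\partial t}(W+\tau_3 Z;\alpha/\mu)\Big],$$ $$0=-\mu\sqrt{\kappa_*}+\mathbb E\Big[Z\,\frac{\partial M_\rho}{\partial x}(W+\tau_3 Z;\alpha/\mu)\Big],$$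 $$0=\frac{\mu}{2}+\frac1\mu\mathbb E\Big[\frac{\partial M_\rho}{\partial t}(W+\tau_3 Z;\alpha/\mu)\Big].$$ Then the three systems are equivalent, in the following sense: (i) (AMP) and (LOO) are converted into each other by $\tau_1=\tau_2$, $\lambda_1=\lambda_2$: a pair $(\tau,\lambda)$ with $\tau,\lambda>0$ solves (AMP) if and only if it solves (LOO). (ii) (AMP) and (CGMT) are converted into each other by $\tau_2=\tau_3$, $\lambda_2=\alpha/\mu$: a pair $(\tau_2,\lambda_2)$ with $\tau_2,\lambda_2>0$ solves (AMP) if and only if there is a solution $(\tau_3,\alpha,\mu)$ of (CGMT) with $\tau_3,\alpha,\mu>0$ such that $\tau_2=\tau_3$ and $\lambda_2=\alpha/\mu$; and every solution of (CGMT) with $\tau_3,\alpha,\mu>0$ yields in this way a solution of (AMP).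
   Context: For a convex function $f:\mathbb R\to\mathbb R$, $x\in\mathbb R$ and $t>0$, the Moreau envelope and the proximal operator are $$M_f(x;t)=\min_{z\in\mathbb R}\Big\{f(z)+\frac{1}{2t}(x-z)^2\Big\},\qquad \mathrm{Prox}_f(x;t)=\arg\min_{z\in\mathbb R}\Big\{f(z)+\frac1{2t}(x-z)^2\Big\}.$$ The symbols $\frac{\partial}{\partial x}$ and $\frac{\partial}{\partial t}$ denote partial derivatives with respect to the first and second argument. The functions $\mathrm{Prox}_f(\cdot;t)$ and $\frac{\partial M_f}{\partial x}(\cdot;t)$ are Lipschitz in $x$, so $\frac{\partial \mathrm{Prox}_f}{\partial x}$ and $\frac{\partial^2 M_f}{\partial x^2}$ exist for almost every $x$ and are understood in this sense. The three systems are the ''state equations'' obtained by the leave-one-out (LOO), approximate message passing (AMP) and convex Gaussian min-max theorem (CGMT) methods for the M-estimator $\hat{\boldsymbol\beta}=\arg\min_{\boldsymbol\beta}\sum_{i=1}^n\rho(y_i-\mathbf x_i^T\boldsymbol\beta)$ in the linear model $y_i=\mathbf x_i^T\boldsymbol\beta^*+\epsilon_i$ with noise law $P_\epsilon$ and $d/n\to\kappa_*$. *)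

(* Defs.v *)
From HB Require Import structures.
From mathcomp Require Import all_boot all_order all_algebra.
From mathcomp Require Import all_classical all_reals all_analysis.

Set Implicit Arguments.
Unset Strict Implicit.
Unset Printing Implicit Defensive.

Import Order.TTheory GRing.Theory Num.Theory.
Import numFieldNormedType.Exports.

Local Open Scope classical_set_scope.
Local Open Scope ring_scope.

Section moreau_prox.
Context {R : realType}.
Implicit Types (f : R -> R) (x t : R).

Definition prox_objective f x t : R -> R :=
  fun z => f z + (2 * t)^-1 * (x - z) ^+ 2.

(* For f convex and t > 0 the objective is continuous, strictly convex and
   coercive, so this infimum is a minimum, attained at exactly one point. *)
Definition moreau f x t : R := inf (range (prox_objective f x t)).

Definition prox f x t : R :=
  xget 0 [set z | forall y, prox_objective f x t z <= prox_objective f x t y].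

(* [derive1] is total: where the derivative does not exist it takes a fixed
   default value.  For f convex and t > 0, [dprox_dx f x t] and
   [d2moreau_dx2 f x t] are genuine derivatives for almost every x only. *)
Definition dprox_dx f x t : R := derive1 (fun y => prox f y t) x.

Definition dmoreau_dx f x t : R := derive1 (fun y => moreau f y t) x.

Definition dmoreau_dt f x t : R := derive1 (fun s => moreau f x s) t.

Definition d2moreau_dx2 f x t : R := derive1 (fun y => dmoreau_dx f y t) x.

End moreau_prox.

Section random_variables.
Context {d : measure_display} {T : measurableType d} {R : realType}.
Variable P : probability T R.

Definition independent_RV (X Y : {RV P >-> R}) : Prop :=
  forall A B : set R, measurable A -> measurable B ->
    P (X @^-1` A `&` Y @^-1` B) = (P (X @^-1` A) * P (Y @^-1` B))%E.

(* Equality is required on Borel sets only: outside its sigma-algebra the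
   underlying set function of a measure is unconstrained. *)
Definition standard_normal (Z : {RV P >-> R}) : Prop :=
  forall A : set R, measurable A -> distribution P Z A = normal_prob 0 1 A.

End random_variables.

(* Expectations are extended-real valued, so each equation below also asserts
   that the expectation it contains is finite. *)
Section state_equations.
Local Open Scope ereal_scope.
Context {d : measure_display} {T : measurableType d} {R : realType}.
Variables (P : probability T R) (rho : R -> R) (kappa : R) (W Z : T -> R).

Definition LOO (tau lambda : R) : Prop :=
  (1 - kappa)%:E =
    'E_P[fun w => (dprox_dx rho (W w + tau * Z w) lambda)%R] /\
  (kappa * tau ^+ 2)%:E =
    'E_P[fun w => ((W w + tau * Z w
                   - prox rho (W w + tau * Z w) lambda) ^+ 2)%R].

Definition AMP (tau lambda : R) : Prop :=
  (tau ^+ 2)%:E =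
    (kappa^-1 * lambda ^+ 2)%:E *
    'E_P[fun w => ((dmoreau_dx rho (W w + tau * Z w) lambda) ^+ 2)%R] /\
  kappa%:E =
    lambda%:E * 'E_P[fun w => (d2moreau_dx2 rho (W w + tau * Z w) lambda)%R].

Definition CGMT (tau alpha mu : R) : Prop :=
  [/\ 0 = (alpha / 2 - tau * Num.sqrt kappa)%:E
       - (alpha / mu ^+ 2)%:E *
         'E_P[fun w => (dmoreau_dt rho (W w + tau * Z w) (alpha / mu))%R],
      0 = - (mu * Num.sqrt kappa)%:E
       + 'E_P[fun w => (Z w * dmoreau_dx rho (W w + tau * Z w) (alpha / mu))%R]
    & 0 = (mu / 2)%:E
       + (mu^-1)%:E *
         'E_P[fun w => (dmoreau_dt rho (W w + tau * Z w) (alpha / mu))%R] ].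

End state_equations.

(* Main.v *)
Require Import Defs.
From HB Require Import structures.
From mathcomp Require Import all_boot all_order all_algebra.
From mathcomp Require Import all_classical all_reals all_analysis.
From mathcomp Require Import measurable_realfun normal_distribution.
From mathcomp Require Import ring lra.

(** Fix lambda > 0, let p be the proximal operator with parameter lambda and
    q x = x - p x its residual.  The variational inequality satisfied by the
    minimizer makes p and q nondecreasing and 1-Lipschitz ([slopes01_prox]), and
    comparing the minimizers at two neighbouring points shows that the envelope
    M is differentiable everywhere in both arguments, with
    dM/dx = q / lambda and dM/dt = - q^2 / (2 lambda^2)
    ([is_derive_moreau_dx], [is_derive_moreau_dt]).

    Put X = W + tau Z.  All the expectations in the three systems are then
    functions of the two numbers G = E[q'(X)] and A = E[q(X)^2]
    ([state_moments_exist]):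
      E[p'(X)] = 1 - G,            lambda E[d2M/dx2] = G,
      lambda^2 E[(dM/dx)^2] = A,   - 2 lambda^2 E[dM/dt] = A,
      lambda E[Z dM/dx] = tau G,
    the last one being Stein's identity.  After substitution, (LOO) and (AMP)
    both say that G = kappa and A = kappa tau^2.  In (CGMT), where
    lambda = alpha / mu, the third equation gives A = alpha^2, the first one
    then gives alpha = tau sqrt(kappa), and the second one gives G = kappa.

    Two facts need real analysis, because q is differentiable only almost
    everywhere.  First, p' = 1 - q' must hold at X almost surely, whereas a
    derivative that does not exist has a default value; this is fine because X
    avoids Lebesgue null sets ([noisy_null]), given W it is Gaussian.  Second,
    Stein's identity is needed for a function that is merely Lipschitz
    ([stein]).  Both rest on [slopes01_density]: q is the integral of its almost
    everywhere derivative.  Given that, Stein's identity conditionally on W is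
    an exchange of two integrals ([gauss_parts]), in which the remaining inner
    integral is that of z phi(z) over a half-line, namely phi at its endpoint. *)

Set Implicit Arguments.
Unset Strict Implicit.
Unset Printing Implicit Defensive.

Import Order.TTheory GRing.Theory Num.Theory.
Import numFieldNormedType.Exports.

Local Open Scope classical_set_scope.
Local Open Scope ring_scope.

(** * Modifying an integrand on a null set *)

Section null_set.
Local Open Scope ereal_scope.
Context d (T : measurableType d) (R : realType).
Variable mu : {measure set T -> \bar R}.
Import HBNNSimple.

(** Simple functions below f are truncated to the complement of N: this leaves
    their integral unchanged and puts them below g. *)
Lemma ge0_le_integral_off_null (N : set T) (f g : T -> \bar R) :
  measurable N -> mu N = 0 -> (forall x, 0 <= f x) -> (forall x, 0 <= g x) ->
  (forall x, ~ N x -> f x = g x) -> \int[mu]_x f x <= \int[mu]_x g x.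
Proof.
move=> mN N0 f0 g0 fg; rewrite !ge0_integralTE//.
apply: ge_ereal_sup => _ [h hf <-]; apply: ereal_sup_ubound.
have mNC : measurable (~` N) by exact: measurableC.
exists (proj_nnsfun h mNC).
  move=> x; rewrite /= mindicE.
  have [xN|xN] := pselect (N x).
    by rewrite memNset ?mulr0// => /(_ xN).
  by rewrite mem_set// mulr1 -fg.
rewrite -[LHS](_ : \int[mu]_x (proj_nnsfun h mNC x)%:E = _); last first.
  by rewrite integral_nnsfun// patch_setT.
rewrite -[RHS](_ : \int[mu]_x (h x)%:E = _); last first.
  by rewrite integral_nnsfun// patch_setT.
apply: ge0_ae_eq_integral => //.
- exact/measurable_EFinP.
- exact/measurable_EFinP.
- by move=> x _; rewrite lee_fin; exact: fun_ge0.
- by move=> x _; rewrite lee_fin; exact: fun_ge0.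
- exists N; split => // x /= hx; apply: contrapT => xN; apply: hx => _.
  by rewrite mindicE mem_set// mulr1.
Qed.

(** Stated for arbitrary functions because the integrands of interest contain
    derivatives that take a default value outside the domain of
    differentiability, so that measurability is only clear off a null set. *)
Lemma integral_off_null (N : set T) (f g : T -> \bar R) :
  measurable N -> mu N = 0 -> (forall x, ~ N x -> f x = g x) ->
  \int[mu]_x f x = \int[mu]_x g x.
Proof.
move=> mN N0 fg; rewrite integralE [RHS]integralE.
congr (_ - _); apply/eqP; rewrite eq_le; apply/andP; split;
  apply: (ge0_le_integral_off_null mN N0) => // x /fg fgx;
  by rewrite ?funeposE ?funenegE ?fgx.
Qed.

End null_set.

(** * Densities of nondecreasing 1-Lipschitz functions *)

(** Nondecreasing and 1-Lipschitz, as a single condition on slopes: in this form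
    it is visibly stable under q |-> id - q. *)
Definition slopes01 (R : realType) (q : R -> R) :=
  forall x y, x <= y -> 0 <= q y - q x <= y - x.

Lemma stieltjes_oc (R : realType) (f : cumulative R R) (a b : R) : a <= b ->
  lebesgue_stieltjes_measure f `]a, b]%classic = (f b - f a)%:E.
Proof.
move=> ab; rewrite /lebesgue_stieltjes_measure /measure_extension/=.
rewrite measurable_mu_extE/=; last exact: is_ocitv.
by rewrite wlength_itv_bnd.
Qed.

Section slopes.
Context (R : realType) (q : R -> R).
Hypothesis q01 : slopes01 q.

Lemma slopes01_nd : nondecreasing q.
Proof. by move=> x y /q01; lra. Qed.

Lemma slopes01C : slopes01 (fun x => x - q x).
Proof. by move=> x y /q01; lra. Qed.

Lemma slopes01_dist x y : `|q x - q y| <= `|x - y|.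
Proof.
wlog xy : x y / x <= y.
  move=> H; have [/H//|/ltW/H] := leP x y.
  by rewrite distrC (distrC y).
rewrite !ler0_norm; have := q01 xy; lra.
Qed.

Lemma slopes01_continuous : continuous q.
Proof.
move=> x; apply/cvgrPdist_le => e e0; near=> y.
apply: le_trans (slopes01_dist _ _) _.
by near: y; exact: cvgr_dist_le.
Unshelve. all: by end_near. Qed.

End slopes.

Section density.
Context (R : realType) (q : R -> R).
Hypothesis q01 : slopes01 q.
Local Notation mu := (@lebesgue_measure R).

Let qc : cumulative R R := HB.pack q
  (isCumulative.Build R _ R q (slopes01_nd q01)
     (right_continuousW (slopes01_continuous q01))).
Let pc : cumulative R R := HB.pack (fun x => x - q x)
  (isCumulative.Build R _ R (fun x => x - q x) (slopes01_nd (slopes01C q01))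
     (right_continuousW (slopes01_continuous (slopes01C q01)))).
Local Notation nu := (lebesgue_stieltjes_measure qc).

(** The Stieltjes measures of q and of id - q add up to the one of id. *)
Lemma stieltjes_le_lebesgue (A : set R) : measurable A -> (nu A <= mu A)%E.
Proof.
move=> mA.
rewrite (@lebesgue_measure_unique R
  (measure_add nu (lebesgue_stieltjes_measure pc)))//; last first.
  move=> _ [[a b] _ <-]; rewrite [RHS]measure_addE/=.
  have [ab|ba] := leP a b; last first.
    by rewrite set_itv_ge ?bnd_simp -?leNgt ?ltW// !measure0 adde0.
  rewrite /lebesgue_measure !stieltjes_oc//= -EFinD; congr _%:E; ring.
by rewrite [leRHS]measure_addE leeDl.
Qed.

(** Radon-Nikodym, applied on a bounded interval, where the Stieltjes measure of
    q is finite. *)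
Lemma local_density (n : nat) : exists g : R -> R,
  mu.-integrable setT (EFin \o g) /\
  forall a b, - n%:R <= a -> a <= b -> b <= n%:R ->
    ((q b - q a)%:E = \int[mu]_(x in `]a, b]) (g x)%:E)%E.
Proof.
pose D : set (measurableTypeR R) := `](- n%:R), n%:R]%classic.
have mD : measurable D by exact: measurable_itv.
have nuoo : (nu D < +oo)%E.
  apply: le_lt_trans (stieltjes_le_lebesgue _) _ => //.
  by rewrite lebesgue_measure_itv; case: ifP => // _; rewrite ltry.
have [|f [f0 ffin fint fE]] :=
    @radon_nikodym_sigma_finite _ _ R mu (mfrestr mD nuoo).
  apply/null_content_dominatesP => A mA A0.
  apply/eqP; rewrite eq_le measure_ge0 andbT -A0.
  apply: le_trans (stieltjes_le_lebesgue _); last exact: mA.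
  by apply: le_measure => //; rewrite ?inE//; exact: measurableI.
have gE : EFin \o (fine \o f) = f by apply/funext => x /=; rewrite fineK.
exists (fine \o f); split; first by rewrite gE.
move=> a b na ab bn.
transitivity (\int[mu]_(x in `]a, b]) f x)%E; last first.
  by apply: eq_integral => x _; rewrite /= fineK.
rewrite -fE; last exact: measurable_itv.
rewrite [RHS](_ : _ = nu (`]a, b]%classic `&` D))// setIidl ?stieltjes_oc//.
by apply: subset_itv; rewrite bnd_simp.
Qed.

(** Lebesgue differentiation of the indefinite integral of g. *)
Lemma local_ae_derive (n : nat) (g : R -> R) :
  mu.-integrable setT (EFin \o g) ->
  (forall a b, - n%:R <= a -> a <= b -> b <= n%:R ->
    ((q b - q a)%:E = \int[mu]_(x in `]a, b]) (g x)%:E)%E) ->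
  {ae mu, forall x : R, - n%:R < x < n%:R -> is_derive x 1 q (g x)}.
Proof.
move=> gi gE.
have gl : locally_integrable setT g.
  by apply: open_integrable_locally gi; exact: openT.
have := @FTC1 R g (BRight (- n%:R)) _ gl.
have giy (y : R) : mu.-integrable `]- n%:R, y] (EFin \o g).
  by apply: integrableS gi => //; exact: measurable_itv.
move=> /(_ giy); apply: filterS; first exact: (ae_filter_ringOfSetsType mu).
move=> x /= + /andP[nx xn] => /(_ nx).
set F := (fun y => _) => -[dF F'].
have qF : is_derive x 1 (fun y => q (- n%:R) + F y) (g x).
  rewrite -[X in is_derive _ _ _ X]add0r -F' derive1E.
  by apply: is_deriveD; exact: derivableP.
apply: near_eq_is_derive qF; near=> y.
have ny : - n%:R < y by near: y; exact: lt_nbhsr.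
have yn : y < n%:R by near: y; exact: lt_nbhsl.
rewrite /F /Rintegral -gE//; [|exact: ltW..].
by rewrite /=; ring.
Unshelve. all: by end_near. Qed.

(** These difference quotients provide a Borel function that agrees with the
    derivative of q wherever it exists. *)
Let h (n : nat) (x : R) := n.+1%:R * (q (x + n.+1%:R^-1) - q x).

Let h01 n x : 0 <= h n x <= 1.
Proof.
have n0 : 0 < (n.+1%:R : R) by rewrite ltr0n.
have /q01 /andP[h0 h1] : x <= x + n.+1%:R^-1 by rewrite lerDl invr_ge0 ltW.
rewrite /h mulr_ge0 ?(ltW n0)//= -ler_pdivlMl// mulr1.
by apply: le_trans h1 _; rewrite addrC addKr.
Qed.

Let mh n : measurable_fun setT (h n).
Proof.
have mq : measurable_fun setT q.
  by apply: continuous_measurable_fun; exact: slopes01_continuous.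
apply: measurable_funM => //; apply: measurable_funB => //.
by apply: measurableT_comp => //; exact: measurable_funD.
Qed.

Let cvg_h (x d : R) : is_derive x 1 q d -> h ^~ x @ \oo --> d.
Proof.
move=> [dq qd].
have /cvgr_dnbhsP : ((fun e : R => e^-1 *: (q (e *: 1 + x) - q x)) @ 0^' --> d).
  by rewrite -qd; exact: dq.
move=> /(_ (fun n => n.+1%:R^-1)) H.
apply: cvg_trans (H _); last first.
  split; last exact: cvg_harmonic.
  by move=> n; rewrite invr_eq0 pnatr_eq0.
apply: near_eq_cvg; near=> n.
by rewrite /h invrK /= [_ *: 1]mulr1 [in LHS](addrC _ x).
Unshelve. all: by end_near. Qed.

(** The local densities all agree almost everywhere with the derivative of q,
    hence with one global Borel function, the upper limit of the difference
    quotients. *)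
Theorem slopes01_density : exists g : R -> R,
  [/\ measurable_fun setT g, forall x, 0 <= g x <= 1,
      {ae mu, forall x : R, is_derive x 1 q (g x)} &
      forall a b, a <= b ->
        ((q b - q a)%:E = \int[mu]_(x in `]a, b]) (g x)%:E)%E].
Proof.
pose g0 x := limn_sup (h ^~ x).
have mg0 : measurable_fun setT g0.
  apply: measurable_fun_limn_sup => // x _.
  - by exists 1 => _ [n _ <-]; have /andP[] := h01 n x.
  - by exists 0 => _ [n _ <-]; have /andP[] := h01 n x.
(* Truncation to [0, 1] only matters where q has no derivative. *)
pose g x := Num.max 0 (Num.min 1 (g0 x)).
have g01 x : 0 <= g x <= 1.
  by rewrite /g le_max lexx/= ge_max ler01/= ge_min lexx.
have mg : measurable_fun setT g.
  by apply: measurable_maxr => //; exact: measurable_minr.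
have gE (x d : R) : is_derive x 1 q d -> g x = d.
  move=> /cvg_h hd; rewrite /g /g0 (cvg_limn_inf_sup hd).2.
  have d0 : 0 <= d.
    have <- := cvg_lim (@Rhausdorff R) hd.
    apply: limr_ge; first by apply/cvg_ex; exists d.
    by apply: nearW => n; have /andP[] := h01 n x.
  have d1 : d <= 1.
    have <- := cvg_lim (@Rhausdorff R) hd.
    apply: limr_le; first by apply/cvg_ex; exists d.
    by apply: nearW => n; have /andP[] := h01 n x.
  by rewrite min_r// max_r.
have [gn /all_and2[gni gnE]] := choice local_density.
have gnd n : {ae mu, forall x : R, - n%:R < x < n%:R -> is_derive x 1 q (gn n x)}.
  by apply: local_ae_derive; [exact: gni|exact: gnE].
exists g; split => //.
- have := ae_foralln gnd; apply: filterS.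
  move=> x /= H.
  pose n := (Num.truncn `|x|).+1.
  have xn : - n%:R < x < n%:R by rewrite -ltr_norml truncnS_gt.
  by have := H n xn => dx; rewrite (gE _ _ dx).
- move=> a b ab.
  pose n := (Num.truncn (`|a| + `|b|)).+1.
  have abn : `|a| + `|b| < n%:R by rewrite truncnS_gt.
  have a0 := normr_ge0 a; have b0 := normr_ge0 b.
  have an : - n%:R < a < n%:R by rewrite -ltr_norml; lra.
  have bn : - n%:R < b < n%:R by rewrite -ltr_norml; lra.
  rewrite (gnE n)//; [|lra..].
  apply: ae_eq_integral => //=.
  + by apply: measurable_funTS; exact: measurable_int (gni n).
  + by apply/measurable_funTS/measurable_EFinP.
  have := gnd n; apply: filterS; first exact: (ae_filter_ringOfSetsType mu).
  move=> x /= H; rewrite in_itv/= => /andP[ax xb].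
  by have /gE -> : is_derive x 1 q (gn n x) by apply: H; lra.
Qed.

End density.

(** * Gaussian integrals on the line *)

Section density_integral.
Local Open Scope ereal_scope.
Context (R : realType).
Local Notation mu := (@lebesgue_measure R).
Local Notation phi := (@normal_pdf R 0 1).

(** The density phi and the Radon-Nikodym derivative of the normal law have the
    same integral on every Borel set, so they agree almost everywhere. *)
Lemma integral_normal_prob (f : R -> \bar R) :
  measurable_fun setT f -> (forall x, 0 <= f x) ->
  \int[normal_prob 0 1]_x f x = \int[mu]_x (f x * (phi x)%:E).
Proof.
move=> mf f0.
pose nu : {finite_measure set (measurableTypeR R) -> \bar R} :=
  [the {finite_measure set (measurableTypeR R) -> \bar R} of normal_prob 0 1].
have numu : nu `<< mu by exact: normal_prob_dominates.
have mphi : measurable_fun setT (fun x => (phi x)%:E).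
  by apply/measurable_EFinP; exact: measurable_normal_pdf.
have RNi := Radon_Nikodym_SigmaFinite.f_integrable numu.
rewrite -[LHS](@Radon_Nikodym_SigmaFinite.change_of_variables _ _ R nu mu numu)//.
apply: ge0_ae_eq_integral => //.
- by apply: emeasurable_funM => //; exact: measurable_int RNi.
- by apply: emeasurable_funM => //; exact: mphi.
- by move=> x _; apply: mule_ge0 => //; exact: Radon_Nikodym_SigmaFinite.f_ge0.
- by move=> x _; apply: mule_ge0 => //; rewrite lee_fin normal_pdf_ge0.
apply: ae_eqe_mul2l; apply: integral_ae_eq => //.
by move=> E _ mE; rewrite -Radon_Nikodym_SigmaFinite.f_integral.
Qed.

(** The measure A |-> t * mu (preimage of A by z |-> w + t z) gives intervals
    their length, hence is the Lebesgue measure. *)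
Lemma integral_affine (w t : R) (f : R -> \bar R) : (0 < t)%R ->
  measurable_fun setT f -> (forall x, 0 <= f x) ->
  \int[mu]_x f x = t%:E * \int[mu]_z f (w + t * z)%R.
Proof.
move=> t0 mf f0.
pose aff := (fun z : measurableTypeR R => w + t * z)%R : _ -> measurableTypeR R.
have maff : measurable_fun setT aff.
  by apply: measurable_funD => //; exact: measurable_funM.
pose nu := pushforward (mscale (NngNum (ltW t0)) mu) aff.
have muE A : measurable A -> mu A = nu A.
  apply: lebesgue_measure_unique.
  move=> _ [[a b] _ <-].
  change (mu `]a, b]%classic = t%:E * mu (aff @^-1` `]a, b]%classic)).
  rewrite (_ : aff @^-1` _ = `](a - w) / t, (b - w) / t]%classic)%R; last first.
    apply/seteqP; split => z /=; rewrite !in_itv/= ltr_pdivrMr// ler_pdivlMr// /aff; lra.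
  rewrite !lebesgue_measure_itv/= !lte_fin ltr_pM2r ?invr_gt0// ltrD2r.
  case: ifPn => ab; last by rewrite mule0.
  by rewrite -!EFinB -EFinM; congr _%:E; field; rewrite gt_eqF.
transitivity (\int[nu]_x f x).
  by apply: eq_measure_integral => A mA _; exact: muE.
rewrite ge0_integral_pushforward// preimage_setT ge0_integral_mscale//.
  exact: (measurableT_comp mf maff).
by move=> x _; exact: f0.
Qed.

Lemma normal_pdf01E x : phi x = (normal_peak 1 * expR (- (x ^+ 2 / 2)))%R.
Proof.
by rewrite /normal_pdf oner_eq0 /normal_fun subr0 expr1n mulNr.
Qed.

Lemma normal_pdf01N x : phi (- x)%R = phi x.
Proof. by rewrite !normal_pdf01E sqrrN. Qed.

Lemma is_derive_normal_pdf01 (x : R) : is_derive x 1%R phi (- (x * phi x))%R.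
Proof.
have -> : phi = (fun x => normal_peak 1 * expR (- (x ^+ 2 / 2)))%R.
  by apply/funext => y; rewrite normal_pdf01E.
apply: is_derive_eq.
by rewrite /GRing.scale/=; field.
Qed.

Lemma cvg_normal_pdf01 : phi x @[x --> +oo%R] --> (0%R : R).
Proof.
rewrite (_ : phi = (fun x => normal_peak 1 * expR (- (x ^+ 2 / 2)))%R); last first.
  by apply/funext => y; rewrite normal_pdf01E.
rewrite -[X in _ --> X](mulr0 (normal_peak (1 : R))).
apply: cvgM; first exact: cvg_cst.
apply: (cvg_comp (fun x : R => x ^+ 2 / 2)%R (fun x => expR (- x))); last first.
  exact: cvgr_expR.
apply: gt0_cvgMly; first by rewrite invr_gt0.
exact: cvgr_expr2.
Qed.

(** An antiderivative of z phi(z) is - phi. *)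
Lemma integral_gauss_tail (s : R) : (0 <= s)%R ->
  \int[mu]_(z in `[s, +oo[) (z * phi z)%:E = (phi s)%:E.
Proof.
move=> s0.
rewrite (@ge0_continuous_FTC2y _ _ (fun x => - phi x)%R s 0%R).
- by rewrite EFinN oppeK add0e.
- by move=> x sx; rewrite mulr_ge0 ?normal_pdf_ge0// (le_trans s0).
- apply: continuous_subspaceT => x; apply: cvgM; first exact: cvg_id.
  by apply: continuous_normal_pdf; exact: oner_neq0.
- rewrite -[X in _ --> X]oppr0; apply: cvgN; exact: cvg_normal_pdf01.
- by move=> x _; apply: derivableN; have [] := is_derive_normal_pdf01 x.
- apply: cvg_at_right_filter; apply: cvgN; apply: continuous_normal_pdf; exact: oner_neq0.
- move=> x _; have [dphi phiE] := is_derive_normal_pdf01 x.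
  by rewrite derive1E deriveN// phiE opprK.
Qed.

Lemma integral_gauss_tailN (s : R) : (s <= 0)%R ->
  \int[mu]_(z in `]-oo, s]) (- z * phi z)%:E = (phi s)%:E.
Proof.
move=> s0.
rewrite -{1}(opprK s) ge0_integration_by_substitutionNy.
- under eq_integral do rewrite /= opprK normal_pdf01N.
  by rewrite integral_gauss_tail ?oppr_ge0// normal_pdf01N.
- apply: continuous_subspaceT => x; apply: cvgM; first exact: cvgN.
  by apply: continuous_normal_pdf; exact: oner_neq0.
- move=> x; rewrite in_itv/= opprK => xs.
  by rewrite mulr_ge0 ?normal_pdf_ge0// oppr_ge0; lra.
Qed.

Lemma integral_normal_pdfN (f : R -> \bar R) :
  measurable_fun setT f -> (forall x, 0 <= f x) ->
  \int[mu]_z (f (- z)%R * (phi z)%:E) = \int[mu]_z (f z * (phi z)%:E).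
Proof.
move=> mf f0.
pose opp := (fun x : measurableTypeR R => - x)%R : _ -> measurableTypeR R.
pose nu := pushforward mu opp.
have mopp : measurable_fun setT opp.
  exact: (@oppr_measurable R setT).
have mh : measurable_fun setT (fun z : measurableTypeR R => f z * (phi z)%:E).
  apply: emeasurable_funM; first exact: mf.
  by apply/measurable_EFinP; exact: measurable_normal_pdf.
have h0 z : 0 <= f z * (phi z)%:E by rewrite mule_ge0// lee_fin normal_pdf_ge0.
transitivity (\int[nu]_z (f z * (phi z)%:E)); last first.
  by apply: eq_measure_integral => A mA _; exact: lebesgue_measureN.
rewrite (ge0_integral_pushforward mopp mu measurableT mh) => [|z _]; last exact: h0.
by rewrite preimage_setT; apply: eq_integral => z _ /=; rewrite normal_pdf01N.
Qed.

Lemma normal_absolute_moment : \int[mu]_z (`|z| * phi z)%:E < +oo.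
Proof.
have mh : measurable_fun setT (fun z : measurableTypeR R => (`|z| * phi z)%:E).
  by apply/measurable_EFinP; apply: measurable_funM => //; exact: measurable_normal_pdf.
rewrite -(setUv `]-oo, 0%R : R]%classic) ge0_integral_setU//; last 4 first.
- exact: measurableC.
- by rewrite setUv.
- by move=> z _; rewrite lee_fin mulr_ge0 ?normal_pdf_ge0.
- by apply/disj_setPCl.
rewrite setCitvl integral_itv_obnd_cbnd; last exact: measurable_funTS.
rewrite -[X in X + _](_ : \int[mu]_(z in `]-oo, 0%R]) (- z * phi z)%:E = _); last first.
  by apply: eq_integral => z; rewrite inE/= in_itv/= => z0; rewrite ler0_norm.
rewrite -[X in _ + X](_ : \int[mu]_(z in `[0%R, +oo[) (z * phi z)%:E = _); last first.
  by apply: eq_integral => z; rewrite inE/= in_itv/= andbT => z0; rewrite ger0_norm.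
by rewrite integral_gauss_tail// integral_gauss_tailN// -EFinD ltry.
Qed.

End density_integral.

Section gauss_parts.
Local Open Scope ereal_scope.
Context (R : realType).
Local Notation mu := (@lebesgue_measure R).
Local Notation phi := (@normal_pdf R 0 1).

(** The region of integration of the double integral behind Stein's identity:
    the pairs (z, s) such that s lies between 0 and z. *)
Let between0 (p : measurableTypeR R * measurableTypeR R) : bool :=
  let z : R := p.1 in let s : R := p.2 in
  ((0 < s <= z) || (z < s <= 0))%R.

Let mbetween0 : measurable_fun setT between0.
Proof.
apply: measurable_or; apply: measurable_and.
- by apply: measurable_fun_ltr.
- by apply: measurable_fun_ler.
- by apply: measurable_fun_ltr.
- by apply: measurable_fun_ler.
Qed.

Let mbetween0_set : measurable [set p | between0 p].
Proof. by rewrite -[X in measurable X]setTI; exact: mbetween0. Qed.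

(** Tonelli: for fixed s > 0 the points z of the region are those with s <= z,
    for fixed s <= 0 those with z < s; in both cases |z| phi(z) integrates to
    phi(s) over them.  One of the two intervals in the union is always empty. *)
Lemma gauss_parts (c : R -> R) : measurable_fun setT c ->
  (forall s, 0 <= c s)%R ->
  \int[mu]_z ((`|z| * phi z)%:E *
              \int[mu]_(s in `]0%R, z] `|` `]z, 0%R]) (c s)%:E) =
  \int[mu]_s (c s * phi s)%:E.
Proof.
move=> mc c0.
have mphi : measurable_fun setT phi by exact: measurable_normal_pdf.
have Eb z s : (s \in (`]0%R, z] `|` `]z, 0%R])%classic) = between0 (z, s).
  apply/idP/idP => [|H]; [rewrite inE|apply/mem_set]; rewrite /= !in_itv/=.
    by case=> H; apply/orP; [left|right].
  by move/orP: H => [] H; [left|right].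
pose F p := (`|p.1| * phi p.1 * c p.2 * (between0 p)%:R)%:E : \bar R.
have mF : measurable_fun setT F.
  apply/measurable_EFinP; apply: measurable_funM.
    apply: measurable_funM.
      apply: measurable_funM; first exact: measurableT_comp.
      exact: (measurableT_comp mphi measurable_fst).
    exact: (measurableT_comp mc measurable_snd).
  rewrite (_ : (fun x => _) = \1_[set p | between0 p]); last first.
    by apply/funext => p; rewrite indicE mem_setE.
  exact: measurable_indic.
have F0 p : 0 <= F p.
  by rewrite lee_fin !mulr_ge0 ?normal_pdf_ge0 ?ler0n.
transitivity (\int[mu]_z \int[mu]_s F (z, s)).
  apply: eq_integral => z _.
  rewrite -ge0_integralZl_EFin//.
  - rewrite [LHS]integral_mkcond; apply: eq_integral => s _.
    by rewrite patchE Eb /F/=; case: ifP => _; rewrite ?mulr1 ?mulr0.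
  - by apply: measurableU; exact: measurable_itv.
  - by move=> s _; rewrite lee_fin.
  - by apply: measurable_funTS; exact/measurable_EFinP.
  - by rewrite mulr_ge0 ?normal_pdf_ge0.
rewrite fubini_tonelli//.
apply: eq_integral => s _.
have -> : (c s * phi s)%:E = (c s)%:E *
    \int[mu]_(z in [set z | between0 (z, s)]) (`|z| * phi z)%:E.
  rewrite EFinM; congr (_ * _).
  have [s0|s0] := ltP (0%R : R) (s : R).
    rewrite -(integral_gauss_tail (ltW s0)).
    rewrite (_ : [set z | between0 (z, s)] = `[s, +oo[%classic); last first.
      apply/seteqP; split=> z; rewrite /between0/= in_itv/= andbT s0/=.
        by move=> /orP[//|]; lra.
      by move=> ->.
    apply: eq_integral => z; rewrite inE/= in_itv/= andbT => sz.
    by rewrite ger0_norm//; lra.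
  rewrite -(integral_gauss_tailN s0).
  rewrite -integral_itv_bndo_bndc; last first.
    apply: measurable_funTS; apply/measurable_EFinP.
    exact: measurable_funM.
  rewrite (_ : [set z | between0 (z, s)] = `]-oo, s[%classic); last first.
    apply/seteqP; split=> z/=; rewrite /between0/= in_itv/= s0/= andbT.
      by move=> /orP[|//]; lra.
    by move=> ->; rewrite orbT.
  apply: eq_integral => z; rewrite inE/= in_itv/= => sz.
  by rewrite ler0_norm//; lra.
rewrite -ge0_integralZl_EFin//.
- rewrite [RHS]integral_mkcond; apply: eq_integral => z _.
  rewrite patchE; case: ifPn => [|]; rewrite ?inE ?notin_setE/= /F/=.
    by move=> ->; rewrite mulr1 -EFinM mulrC.
  by move=> /negP/negbTE ->; rewrite mulr0.
- rewrite (_ : [set z | _] = ysection [set p | between0 p] s).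
    exact: measurable_ysection.
  by apply/seteqP; split=> z /=; rewrite /ysection/= inE.
- by move=> z _; rewrite lee_fin mulr_ge0 ?normal_pdf_ge0.
- apply: measurable_funTS; apply/measurable_EFinP.
  by apply: measurable_funM.
Qed.

(** Stein's identity at a fixed value w of W.  Subtracting q w makes the
    integrand nonnegative: q (w + t z) - q w is the integral of
    s |-> t * g (w + t s) between 0 and z, and [gauss_parts] applies. *)
Lemma gauss_parts_density (q g : R -> R) (w t : R) : (0 < t)%R ->
  measurable_fun setT g -> (forall x, 0 <= g x)%R ->
  (forall a b, (a <= b)%R ->
    (q b - q a)%:E = \int[mu]_(x in `]a, b]) (g x)%:E) ->
  \int[mu]_z (z * (q (w + t * z) - q w) * phi z)%:E =
  t%:E * \int[mu]_z (g (w + t * z) * phi z)%:E.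
Proof.
move=> t0 mg g0 gE.
have mgw : measurable_fun setT (fun s : R => g (w + t * s)%R).
  by apply: (measurableT_comp mg); exact: measurable_funD.
have mphi : measurable_fun setT phi by exact: measurable_normal_pdf.
have incr a b : (a <= b)%R ->
    \int[mu]_(s in `]a, b]) (t * g (w + t * s))%:E =
    (q (w + t * b) - q (w + t * a))%:E.
  move=> ab; rewrite gE; last by rewrite lerD2l ler_pM2l.
  have mab : measurable (`](w + t * a)%R, (w + t * b)%R]%classic : set (measurableTypeR R)).
    exact: measurable_itv.
  rewrite [RHS]integral_mkcond/= (integral_affine w t0)//; last 2 first.
  - apply/(measurable_restrictT _ _).1 => //.
    by apply: measurable_funTS; exact/measurable_EFinP.
  - by move=> x; rewrite patchE; case: ifP; rewrite // lee_fin.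
  under eq_integral do rewrite EFinM.
  rewrite ge0_integralZl_EFin//; last 3 first.
  - by move=> x _; rewrite lee_fin.
  - by apply: measurable_funTS; exact/measurable_EFinP.
  - exact: ltW.
  congr (_ * _); rewrite integral_mkcond; apply: eq_integral => s _.
  rewrite !patchE; congr (if _ then _ else _).
  apply/idP/idP; rewrite !inE/= !in_itv/= !ltrD2l !lerD2l !ltr_pM2l// !ler_pM2l//.
rewrite -ge0_integralZl_EFin//; last 3 first.
- by move=> z _; rewrite lee_fin mulr_ge0 ?normal_pdf_ge0.
- by apply/measurable_EFinP; exact: measurable_funM.
- exact: ltW.
rewrite [RHS](_ : _ = \int[mu]_s (t * g (w + t * s) * phi s)%:E); last first.
  by apply: eq_integral => s _; rewrite -EFinM mulrA.
rewrite -(@gauss_parts (fun s => t * g (w + t * s))%R); last 2 first.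
- exact: measurable_funM.
- by move=> s; rewrite mulr_ge0// ltW.
apply: eq_integral => z _.
have [z0|z0] := leP (0%R : R) (z : R).
  rewrite [X in _ `|` X]set_itv_ge ?setU0; last by rewrite bnd_simp -leNgt.
  rewrite incr// -EFinM mulr0 addr0 ger0_norm//; congr _%:E; ring.
rewrite [X in X `|` _]set_itv_ge ?set0U; last by rewrite bnd_simp -leNgt ltW.
rewrite incr ?ltW// -EFinM mulr0 addr0 ltr0_norm//; congr _%:E; ring.
Qed.

End gauss_parts.

(** * A Gaussian perturbation of an independent variable *)

Section joint_law.
Local Open Scope ereal_scope.
Context d (T : measurableType d) (R : realType) (P : probability T R).
Variables W Z : {RV P >-> R}.
Hypothesis Zn : standard_normal Z.
Hypothesis WZ : independent_RV W Z.
Local Notation mu := (@lebesgue_measure R).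
Local Notation phi := (@normal_pdf R 0 1).
Local Notation PW := (distribution P W).

(** Independence makes the law of (W, Z) a product measure, since both agree on
    rectangles; then Tonelli. *)
Lemma ge0_integral_joint (F : R * R -> \bar R) :
  measurable_fun setT F -> (forall p, 0 <= F p) ->
  \int[P]_x F (W x, Z x) = \int[PW]_w \int[mu]_z (F (w, z) * (phi z)%:E).
Proof.
move=> mF F0.
pose WZp x : R * measurableTypeR R := (W x, Z x).
pose F' : R * measurableTypeR R -> \bar R := F.
have mF' : measurable_fun setT F' by exact: mF.
have mWZ : measurable_fun setT WZp.
  have mZ : measurable_fun setT (Z : T -> R) by exact: measurable_funPT.
  by apply: measurable_fun_pair; [exact: measurable_funPT|exact: mZ].
transitivity (\int[pushforward P WZp]_p F' p).
  by rewrite ge0_integral_pushforward// preimage_setT.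
pose N01 : probability (measurableTypeR R) R := normal_prob 0 1.
transitivity (\int[PW \x N01]_p F' p).
  apply/esym; apply: eq_measure_integral => A mA _.
  apply: product_measure_unique => // B C mB mC.
  change (P (W @^-1` B `&` Z @^-1` C) = P (W @^-1` B) * N01 C).
  by rewrite WZ//; congr (_ * _); exact: Zn.
rewrite fubini_tonelli1; [|exact: mF'|by []].
apply: eq_integral => w _; rewrite /fubini_F integral_normal_prob//.
exact: (measurableT_comp mF (measurable_pair1 w)).
Qed.

End joint_law.

Section gaussian_noise.
Local Open Scope ereal_scope.
Context d (T : measurableType d) (R : realType) (P : probability T R).
Variables W Z : {RV P >-> R}.
Hypothesis Zn : standard_normal Z.
Hypothesis WZ : independent_RV W Z.
Local Notation mu := (@lebesgue_measure R).
Local Notation phi := (@normal_pdf R 0 1).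

(** The reflection z |-> - z preserves the law of Z and exchanges the positive
    and the negative part of z q(w); both have a finite integral. *)
Lemma centered_product (q : R -> R) : measurable_fun setT q ->
  P.-integrable setT (fun x => (q (W x))%:E) ->
  P.-integrable setT (fun x => (Z x * q (W x))%:E) /\
    \int[P]_x (Z x * q (W x))%:E = 0.
Proof.
move=> mq qi.
have mphi : measurable_fun setT phi by exact: measurable_normal_pdf.
pose G (p : R * R) := (p.2 * q p.1)%R.
have mG : measurable_fun setT G by apply: measurable_funM => //; exact: measurableT_comp.
have mZq : measurable_fun setT (fun x => (Z x * q (W x))%:E).
  apply/measurable_EFinP; apply: measurable_funM => //.
  exact: (measurableT_comp mq).
have Zqi : P.-integrable setT (fun x => (Z x * q (W x))%:E).
  apply/integrableP; split => //.
  rewrite (ge0_integral_joint Zn WZ (F := fun p => `|(G p)%:E|))//; last first.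
    by apply: measurableT_comp => //; exact/measurable_EFinP.
  have I w : \int[mu]_z (`|(G (w, z))%:E| * (phi z)%:E) =
      `|(q w)%:E| * \int[mu]_z (`|z| * phi z)%:E.
    rewrite -ge0_integralZl//.
    - apply: eq_integral => z _; rewrite /= -!EFinM /G/= normrM; congr _%:E; ring.
    - by apply/measurable_EFinP; apply: measurable_funM.
    - by move=> z _; rewrite lee_fin mulr_ge0 ?normal_pdf_ge0.
  under eq_integral do rewrite I.
  rewrite ge0_integralZr//; last 2 first.
  - by apply: measurableT_comp => //; exact/measurable_EFinP.
  - by apply: integral_ge0 => z _; rewrite lee_fin mulr_ge0 ?normal_pdf_ge0.
  rewrite lte_mul_pinfty//.
  - by apply: integral_ge0.
  - rewrite ge0_fin_numE; last by apply: integral_ge0.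
    rewrite ge0_integral_distribution//; last first.
      by apply: measurableT_comp => //; exact/measurable_EFinP.
    by have /integrableP[] := qi.
  - exact: normal_absolute_moment.
split => //; rewrite integralE.
suff -> : \int[P]_x (fun x => (Z x * q (W x))%:E)^\+ x =
          \int[P]_x (fun x => (Z x * q (W x))%:E)^\- x.
  by apply: subee; apply: integrable_neg_fin_num.
have mGp : measurable_fun setT (fun p => maxe (G p)%:E 0).
  by apply: measurable_maxe => //; exact/measurable_EFinP.
have mGn : measurable_fun setT (fun p => maxe (- (G p)%:E) 0).
  by apply: measurable_maxe => //; apply: measurableT_comp => //; exact/measurable_EFinP.
under eq_integral do rewrite funeposE.
under [RHS]eq_integral do rewrite funenegE.
rewrite (ge0_integral_joint Zn WZ mGp); last first.
  by move=> p; rewrite le_max lexx orbT.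
rewrite (ge0_integral_joint Zn WZ mGn); last first.
  by move=> p; rewrite le_max lexx orbT.
apply: eq_integral => w _ /=.
rewrite -[LHS]integral_normal_pdfN.
- by apply: eq_integral => z _; rewrite /G/= mulNr EFinN.
- exact: (measurableT_comp mGp (measurable_pair1 w)).
- by move=> z; rewrite le_max lexx orbT.
Qed.

Section noisy.
Variable t : R.
Hypothesis t0 : (0 < t)%R.

(** Given W, the variable W + t Z has a density. *)
Lemma noisy_null (N : set R) : measurable N -> mu N = 0 ->
  P [set x | N (W x + t * Z x)%R] = 0.
Proof.
move=> mN N0.
have mN' : measurable (N : set (measurableTypeR R)) by [].
have maff : measurable_fun setT (fun p : R * R => p.1 + t * p.2)%R.
  by apply: measurable_funD => //; exact: measurable_funM.
pose F (p : R * R) : \bar R := (\1_N (p.1 + t * p.2)%R)%:E.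
have mF : measurable_fun setT F.
  apply/measurable_EFinP; apply: (measurableT_comp _ maff).
  exact: measurable_indic.
have mX : measurable_fun setT (fun x => W x + t * Z x)%R.
  by apply: measurable_funD => //; exact: measurable_funM.
have mXN : measurable [set x | N (W x + t * Z x)%R].
  by rewrite -[X in measurable X]setTI; exact: mX.
rewrite -[X in P X]setIT -integral_indic//.
rewrite -[LHS](_ : \int[P]_x F (W x, Z x) = _)//.
rewrite (ge0_integral_joint Zn WZ)//; last by move=> p; rewrite lee_fin.
rewrite integral0_eq// => w _.
(* For fixed w, the values of Z that lead into N form an affine image of N. *)
pose M : set (measurableTypeR R) := [set z | N (w + t * z)%R].
have mM : measurable M.
  rewrite -[X in measurable X]setTI.
  exact: (measurableT_comp maff (measurable_pair1 w)).
have M0 : mu M = 0.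
  have : mu N = t%:E * mu M.
    rewrite -[in LHS](setIT N) -integral_indic// -[in RHS](setIT M) -integral_indic//.
    rewrite (integral_affine w t0)//.
    by apply/measurable_EFinP; exact: measurable_indic.
  by rewrite N0 => /esym/eqP; rewrite mule_eq0 eqe gt_eqF//= => /eqP.
rewrite (integral_off_null (g := cst 0) mM M0) ?integral0// => z Mz.
by rewrite /F/= indicE memNset ?mul0e.
Qed.

(** Split q(W + t Z) as q(W) plus an increment.  Multiplied by Z, the increment
    is nonnegative and is handled by [gauss_parts_density] for each value of W,
    and q(W) has integral zero because Z is centered and independent of W. *)
Lemma stein (q g : R -> R) : P.-integrable setT (EFin \o W) -> slopes01 q ->
  measurable_fun setT g -> (forall x, 0 <= g x <= 1)%R ->
  (forall a b, (a <= b)%R ->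
    (q b - q a)%:E = \int[mu]_(x in `]a, b]) (g x)%:E) ->
  P.-integrable setT (fun x => (Z x * q (W x + t * Z x))%:E) /\
  \int[P]_x (Z x * q (W x + t * Z x))%:E =
  t%:E * \int[P]_x (g (W x + t * Z x))%:E.
Proof.
move=> Wi q01 mg g01 gE.
have g0 x : (0 <= g x)%R by have /andP[] := g01 x.
have mq : measurable_fun setT q.
  by apply: continuous_measurable_fun; exact: slopes01_continuous.
have maff : measurable_fun setT (fun p : R * R => p.1 + t * p.2)%R.
  by apply: measurable_funD => //; exact: measurable_funM.
have mX : measurable_fun setT (fun x => W x + t * Z x)%R.
  by apply: measurable_funD => //; exact: measurable_funM.
pose F (p : R * R) := (p.2 * (q (p.1 + t * p.2) - q p.1))%R.
have F0 p : (0 <= F p)%R.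
  case: p => w z; rewrite /F/=; have [z0|z0] := leP 0%R z.
    apply: mulr_ge0 => //.
    by have /q01/andP[] : (w <= w + t * z)%R by rewrite lerDl mulr_ge0// ltW.
  apply: mulr_le0; first exact: ltW.
  have /q01 : (w + t * z <= w)%R by rewrite gerDl mulr_ge0_le0// ltW.
  lra.
have mF : measurable_fun setT F.
  apply: measurable_funM => //; apply: measurable_funB.
    exact: (measurableT_comp mq).
  exact: (measurableT_comp mq).
have IF : \int[P]_x (F (W x, Z x))%:E = t%:E * \int[P]_x (g (W x + t * Z x))%:E.
  have mgX : measurable_fun setT (fun p : R * R => g (p.1 + t * p.2)%R).
    exact: (measurableT_comp mg).
  rewrite (ge0_integral_joint Zn WZ (F := EFin \o F))//; last first.
    exact/measurable_EFinP.
  rewrite -ge0_integralZl_EFin//; last 3 first.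
  - by move=> x _; rewrite lee_fin.
  - by apply/measurable_EFinP; exact: measurableT_comp mX.
  - exact: ltW.
  have mtg : measurable_fun setT (fun p : R * R => t%:E * (g (p.1 + t * p.2)%R)%:E).
    by apply: measurable_funeM; exact/measurable_EFinP.
  rewrite (ge0_integral_joint Zn WZ mtg); last first.
    by move=> p; rewrite -EFinM lee_fin mulr_ge0// ltW.
  apply: eq_integral => w _ /=.
  rewrite (gauss_parts_density w t0 mg g0 gE).
  rewrite -ge0_integralZl_EFin//; last 3 first.
  - by move=> z _; rewrite lee_fin mulr_ge0 ?normal_pdf_ge0.
  - apply/measurable_EFinP; apply: measurable_funM; last exact: measurable_normal_pdf.
    exact: (measurableT_comp mgX (measurable_pair1 w)).
  - exact: ltW.
  by apply: eq_integral => z _; rewrite -!EFinM mulrA.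
have Fi : P.-integrable setT (fun x => (F (W x, Z x))%:E).
  apply/integrableP; split.
    apply/measurable_EFinP; apply: (measurableT_comp mF).
    by apply: measurable_fun_pair; exact: measurable_funPT.
  under eq_integral do rewrite gee0_abs ?lee_fin//.
  rewrite IF lte_mul_pinfty ?lee_fin ?ltW//.
  apply: (@le_lt_trans _ _ (\int[P]_x 1)); last first.
    by rewrite integral_cst//= mul1e probability_setT ltry.
  apply: ge0_le_integral => //.
  - by move=> x _; rewrite lee_fin.
  - by apply/measurable_EFinP; exact: (measurableT_comp mg).
  - by move=> x _; rewrite lee_fin; have /andP[] := g01 (W x + t * Z x)%R.
have [qi q0] : P.-integrable setT (fun x => (Z x * q (W x))%:E) /\
    \int[P]_x (Z x * q (W x))%:E = 0.
  apply: centered_product => //.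
  apply: (le_integrable measurableT (g := fun x => (`|q 0| + `|W x|)%:E)).
  - by apply/measurable_EFinP; exact: (measurableT_comp mq).
  - move=> x _; rewrite /= lee_fin (ger0_norm (addr_ge0 _ _))//.
    have := slopes01_dist q01 (W x) 0; rewrite subr0.
    have := ler_normD (q (W x) - q 0)%R (q 0%R); rewrite subrK; lra.
  - under eq_fun do rewrite EFinD.
    apply: integrableD => //.
      exact: finite_measure_integrable_cst.
    exact: integrable_abse Wi.
have -> : (fun x => (Z x * q (W x + t * Z x))%:E) =
    (fun x => (F (W x, Z x))%:E) \+ (fun x => (Z x * q (W x))%:E).
  by apply/funext => x; rewrite /= -EFinD /F/=; congr _%:E; ring.
by split; [exact: integrableD|rewrite integralD// q0 adde0].
Qed.

End noisy.

End gaussian_noise.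

(** * Proximal operator and Moreau envelope *)

Section quadratic.
Context (R : realType).

Lemma quadratic_is_derive (F : R -> R) (x d C e : R) : 0 < e ->
  (forall h, `|h| < e -> `|F (x + h) - F x - h * d| <= C * h ^+ 2) ->
  is_derive x 1 F d.
Proof.
move=> e0 FC.
suff H : (fun h : R => h^-1 *: (F (h *: 1 + x) - F x)) @ 0^' --> d.
  apply: DeriveDef; first by apply/cvg_ex; exists d; exact: H.
  by apply/cvg_lim; [exact: Rhausdorff|exact: H].
apply/cvgrPdist_le => r r0; near=> h.
have h0 : h != 0 by near: h; exact: nbhs_dnbhs_neq.
have he : `|h| < e by near: h; exact: dnbhs0_lt.
have hC : `|h| <= r / (`|C| + 1).
  by near: h; apply: dnbhs0_le; rewrite divr_gt0// ltr_pwDr.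
have := FC h he; rewrite /GRing.scale/= mulr1 (addrC x).
have -> : d - h^-1 * (F (h + x) - F x) = - (h^-1 * (F (h + x) - F x - h * d)).
  by field.
rewrite normrN normrM normfV => FCh.
rewrite ler_pdivrMl ?normr_gt0//.
apply: le_trans FCh _.
rewrite -real_normK ?num_real// expr2 mulrCA ler_wpM2l//.
move: hC; rewrite ler_pdivlMr ?ltr_pwDr// => hC.
apply: le_trans hC; rewrite mulrC ler_wpM2l//.
by rewrite (le_trans (ler_norm _))// lerDl.
Unshelve. all: by end_near. Qed.

End quadratic.

Section convex.
Context (R : realType) (f : R -> R).
Hypothesis f_convex : convex_function [set: R] f.

Lemma convexE (s x y : R) : 0 <= s <= 1 ->
  f (s * x + (1 - s) * y) <= s * f x + (1 - s) * f y.
Proof.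
move=> /andP[s0 s1].
by have := @f_convex (Itv01 s0 s1) x y (mem_setT _) (mem_setT _).
Qed.

(** Chord slopes increase: x + h u lies between x and x + u, while x lies between
    x - u and x + h u. *)
Lemma convex_chord_bounds (x u h : R) : 0 <= h <= 1 ->
  h * (f x - f (x - u)) <= f (x + h * u) - f x <= h * (f (x + u) - f x).
Proof.
move=> /andP[h0 h1]; apply/andP; split; last first.
  have := @convexE h (x + u) x; rewrite h0 h1 => /(_ isT).
  by rewrite (_ : h * (x + u) + (1 - h) * x = x + h * u); [lra|ring].
have h10 : 0 < 1 + h by lra.
have := @convexE (1 + h)^-1 (x + h * u) (x - u).
rewrite invr_ge0 ltW//= invf_le1// lerDl h0 => /(_ isT).
rewrite (_ : (1 + h)^-1 * (x + h * u) + (1 - (1 + h)^-1) * (x - u) = x); last first.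
  by field; rewrite gt_eqF.
rewrite (_ : (1 + h)^-1 * f (x + h * u) + _ =
    (f (x + h * u) + h * f (x - u)) / (1 + h)); last first.
  by field; rewrite gt_eqF.
by rewrite ler_pdivlMr//; lra.
Qed.

Lemma convex_continuous : continuous f.
Proof.
move=> x; apply/cvgrPdist_le => e e0.
pose C := `|f (x + 1) - f x| + `|f (x - 1) - f x| + 1.
have C0 : 0 < C by rewrite ltr_pwDr// addr_ge0.
have fC h : `|h| <= 1 -> `|f (x + h) - f x| <= `|h| * C.
  move=> h1.
  have := ler_norm (f (x + 1) - f x); have := normr_ge0 (f (x + 1) - f x).
  have := ler_norm (f (x - 1) - f x); have := normr_ge0 (f (x - 1) - f x).
  move=> n1 l1 n2 l2.
  have Ca : f (x + 1) - f x <= C by rewrite /C; lra.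
  have Cb : f (x - 1) - f x <= C by rewrite /C; lra.
  have [h0|h0] := leP 0 h.
    have := @convex_chord_bounds x 1 h; rewrite -{1 2}(ger0_norm h0) h1 normr_ge0 => /(_ isT).
    rewrite mulr1 (ger0_norm h0) ler_norml => /andP[H1 H2]; apply/andP; split; nra.
  have := @convex_chord_bounds x (-1) (- h); rewrite -{1 2}(ltr0_norm h0) h1 normr_ge0 => /(_ isT).
  rewrite mulrNN mulr1 opprK (ltr0_norm h0) ler_norml => /andP[H1 H2]; apply/andP; split; nra.
near=> y.
rewrite distrC -{1}(subrKC x y).
have yx1 : `|y - x| <= 1 by rewrite distrC; near: y; exact: cvgr_dist_le.
have yxe : `|y - x| <= e / C.
  by rewrite distrC; near: y; apply: cvgr_dist_le => //; rewrite divr_gt0.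
by apply: le_trans (fC _ yx1) _; rewrite -ler_pdivlMr.
Unshelve. all: by end_near. Qed.

Hypothesis f_ge0 : forall x, 0 <= f x.

Section prox.
Variable t : R.
Hypothesis t0 : 0 < t.

(** As f >= 0, the objective is at least its value f x at x once |y - x| > r,
    for the r chosen below; inside that radius a continuous function attains its
    minimum. *)
Lemma prox_exists x :
  exists z, forall y, prox_objective f x t z <= prox_objective f x t y.
Proof.
pose r := f x * (2 * t) + 1.
have r1 : 1 <= r by rewrite lerDr mulr_ge0// mulr_ge0// ltW.
have t20 : 0 < 2 * t by rewrite mulr_gt0.
have cobj : continuous (prox_objective f x t).
  move=> z; apply: cvgD; first exact: convex_continuous.
  apply: cvgM; first exact: cvg_cst.
  apply: (@cvg_comp _ _ _ (fun z => x - z) (fun z => z ^+ 2)).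
    by apply: cvgB; [exact: cvg_cst|exact: cvg_id].
  exact: exprn_continuous.
have [|z _ zmin] := @EVT_min _ (prox_objective f x t) (x - r) (x + r) _
  (continuous_subspaceT cobj); first lra.
exists z => y; have [yr|yr] := leP `|y - x| r.
  by apply: zmin; rewrite in_itv/= -ler_distl.
apply: (@le_trans _ _ (prox_objective f x t x)).
  by apply: zmin; rewrite in_itv/=; lra.
rewrite /prox_objective subrr expr0n/= mulr0 addr0.
have : f x <= (2 * t)^-1 * (x - y) ^+ 2.
  rewrite ler_pdivlMl// mulrC -real_normK ?num_real// distrC.
  by rewrite -/r; move: yr; rewrite /r; nra.
have := f_ge0 y; lra.
Qed.

Lemma proxP x y :
  prox_objective f x t (prox f x t) <= prox_objective f x t y.
Proof. by have /(_ y) := xgetPex 0 (prox_exists x). Qed.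

Lemma moreauE x : moreau f x t = prox_objective f x t (prox f x t).
Proof.
apply/eqP; rewrite eq_le; apply/andP; split.
  apply: ge_inf; last by exists (prox f x t).
  by exists (prox_objective f x t (prox f x t)) => _ [y _ <-]; exact: proxP.
apply: lb_le_inf; first by exists (prox_objective f x t (prox f x t)), (prox f x t).
by move=> _ [y _ <-]; exact: proxP.
Qed.

(** First-order optimality of the minimizer p: compare p with the points
    p + s (y - p), use convexity, divide by s and let s tend to 0. *)
Lemma prox_variational x y :
  f (prox f x t) + t^-1 * (x - prox f x t) * (y - prox f x t) <= f y.
Proof.
set p := prox f x t; set u := t^-1.
have u0 : 0 < u by rewrite invr_gt0.
have step s : 0 <= s <= 1 ->
    s * (f p + u * (x - p) * (y - p) - f y) <= s ^+ 2 * (u / 2 * (y - p) ^+ 2).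
  move=> s01; have := proxP x (s * y + (1 - s) * p); have := convexE y p s01.
  rewrite /prox_objective invfM -/u -/p (mulrC 2^-1) => cv.
  rewrite (_ : x - (s * y + (1 - s) * p) = (x - p) - s * (y - p)); last ring.
  move: cv; set a := f (_ + _); nra.
set D := f p + _ - f y in step.
set K := u / 2 * _ in step.
have K0 : 0 <= K by rewrite mulr_ge0 ?sqr_ge0// divr_ge0// ltW.
rewrite -subr_le0 -/D leNgt; apply/negP => D0.
have DK : 0 < D + K + 1 by lra.
(* A value of s for which s K < D. *)
pose s := D / (D + K + 1).
have sE : s * (D + K + 1) = D by rewrite /s divfK ?gt_eqF.
have s0 : 0 < s by rewrite divr_gt0.
have s1 : s <= 1 by rewrite ler_pdivrMr// mul1r; lra.
have := step s; rewrite (ltW s0) s1 => /(_ isT).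
rewrite expr2 -mulrA ler_pM2l//; nra.
Qed.

(** Adding the variational inequalities at x and at y, each tested at the other
    minimizer, gives (p' - p)^2 <= (y - x) (p' - p). *)
Lemma slopes01_prox : slopes01 (fun x => prox f x t).
Proof.
move=> x y xy.
have := prox_variational x (prox f y t); have := prox_variational y (prox f x t).
set p := prox f x t; set p' := prox f y t.
have u0 : 0 < t^-1 by rewrite invr_gt0.
move: (t^-1) u0 => u u0 H1 H2.
have : u * ((y - x - (p' - p)) * (p' - p)) >= 0 by lra.
rewrite pmulr_rge0//; nra.
Qed.

(** The minimizer at x is a competitor at x + h and conversely, which bounds the
    increment of the envelope on both sides; the two bounds differ by O(h^2)
    because the minimizer is Lipschitz in x. *)
Lemma is_derive_moreau_dx (x : R) :
  is_derive x 1 (fun y => moreau f y t) ((x - prox f x t) / t).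
Proof.
apply: (@quadratic_is_derive _ _ x _ (t^-1 / 2) 1 ltr01) => h _.
rewrite !moreauE.
have := proxP x (prox f (x + h) t); have := proxP (x + h) (prox f x t).
have pn : h * (prox f (x + h) t - prox f x t) <= h ^+ 2.
  have [h0|h0] := leP 0 h.
    have : x <= x + h by lra.
    move=> /slopes01_prox /andP[_]; nra.
  have : x + h <= x by lra.
  move=> /slopes01_prox /andP[_]; nra.
rewrite /prox_objective invfM (mulrC 2^-1).
have u0 : 0 < t^-1 by rewrite invr_gt0.
move: (t^-1) u0 => u u0.
move: (prox f x t) (prox f (x + h) t) pn => p p' pn.
move: (f p) (f p') => a b H1 H2.
have : u * (h * (p' - p)) <= u * h ^+ 2 by rewrite ler_pM2l.
rewrite ler_norml => upn; apply/andP; split; lra.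
Qed.

End prox.

(** In terms of v = 1 / s the objective is affine in v, so the competitor
    argument yields the derivative q^2 / 2 of N; the error is quadratic because
    the minimizer is locally Lipschitz in v.  The chain rule with s |-> 1 / s
    gives the result. *)
Lemma is_derive_moreau_dt (x t : R) : 0 < t ->
  is_derive t 1 (fun s => moreau f x s) (- ((x - prox f x t) ^+ 2 / (2 * t ^+ 2))).
Proof.
move=> t0.
pose N v := moreau f x v^-1.
pose q s := x - prox f x s.
have u0 : 0 < t^-1 by rewrite invr_gt0.
have dN : is_derive t^-1 1 N (q t ^+ 2 / 2).
  apply: (@quadratic_is_derive _ _ _ _ (3 * q t ^+ 2 * t) (t^-1 / 2)).
    by rewrite divr_gt0.
  move=> h hu; rewrite /N invrK.
  pose v := t^-1 + h.
  have v0 : t^-1 / 2 < v by move: hu; rewrite /v ltr_norml; lra.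
  have s0 : 0 < v^-1 by rewrite invr_gt0; lra.
  rewrite -/v !moreauE//.
  have := proxP s0 x (prox f x t); have := proxP t0 x (prox f x v^-1).
  have := prox_variational s0 x (prox f x t).
  have := prox_variational t0 x (prox f x v^-1).
  rewrite /prox_objective !invfM invrK !(mulrC 2^-1).
  have hv : h = v - t^-1 by rewrite /v; ring.
  have tu : t * t^-1 = 1 by rewrite divff// gt_eqF.
  move: hu; rewrite hv -/(q t).
  rewrite -[x - prox f x v^-1]/(q v^-1).
  have -> : prox f x t = x - q t by rewrite /q; ring.
  have -> : prox f x v^-1 = x - q v^-1 by rewrite /q; ring.
  move: (f _) (f _) => a b.
  move: (q t) (q v^-1) => e e'.
  move: {hv} (t^-1) u0 v0 tu => u u0 v0 tu hu V1 V2 P1 P2.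
  (* Here u and v are the inverse parameters, e and e' the residuals, a and b
     the values of f at the two minimizers, e' and a belonging to v. *)
  pose k := v - u; pose c := e - e'.
  have vc : v * c ^+ 2 <= k * (e * c) by rewrite /k /c; nra.
  have uc : u * `|c| <= 2 * (`|k| * `|e|).
    have [->|c0] := eqVneq c 0; first by rewrite normr0 mulr0 !mulr_ge0.
    have c1 : 0 < `|c| by rewrite normr_gt0.
    have : v * `|c| <= `|k| * `|e|.
      rewrite -(ler_pM2r c1) -!mulrA -!normrM -expr2 ger0_norm ?sqr_ge0//.
      exact: le_trans vc (ler_norm _).
    nra.
  have ce : `|c| <= `|e|.
    by rewrite -(ler_pM2l u0); apply: le_trans uc _; have := normr_ge0 e; rewrite /k; nra.
  have ct : `|c| <= 2 * (`|k| * `|e|) * t.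
    have := ler_wpM2l (ltW t0) uc.
    by rewrite [t * (u * _)]mulrA tu mul1r [leRHS]mulrC.
  have err : `|k / 2 * (e' ^+ 2 - e ^+ 2)| <= 3 * e ^+ 2 * t * k ^+ 2.
    rewrite (_ : _ - _ = - (c * (2 * e - c))); last by rewrite /c; ring.
    rewrite mulrN normrN !normrM (ger0_norm (x := 2^-1)) ?invr_ge0//.
    have : `|2 * e - c| <= 3 * `|e|.
      by apply: le_trans (ler_normB _ _) _; rewrite normrM ger0_norm//; lra.
    rewrite -(real_normK (num_real e)) -(real_normK (num_real k)).
    have := normr_ge0 (2 * e - c).
    have := normr_ge0 c; have := normr_ge0 e; have := normr_ge0 k.
    move: (`|c|) (`|e|) (`|k|) (`|2 * e - c|) ct => c' e1 k' m ct k0 e0 c0 m0 m3.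
    have : c' * m <= (2 * (k' * e1) * t) * (3 * e1).
      exact: ler_pM.
    move=> H; have := ler_wpM2l k0 H; lra.
  have E0 : 0 <= 3 * e ^+ 2 * t * k ^+ 2 by apply: le_trans err.
  move: err; rewrite ler_norml -/k => /andP[err _].
  rewrite ler_norml; apply/andP; split; rewrite /k in err E0 *; lra.
have tn0 : t != 0 by rewrite gt_eqF.
have -> : (fun s => moreau f x s) = N \o GRing.inv.
  by apply/funext => s; rewrite /N/= invrK.
have dV : is_derive t 1 GRing.inv (- t ^- 2 *: 1).
  exact: (@is_deriveV _ id t 1 1).
apply: is_derive_eq.
rewrite /q /GRing.scale/=; field.
by rewrite gt_eqF.
Qed.

End convex.

(** * The state equations *)

Section moments.
Local Open Scope ereal_scope.
Context d (T : measurableType d) (R : realType) (P : probability T R).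
Variables (rho : R -> R) (W Z : {RV P >-> R}).
Hypothesis rho_ge0 : forall x, (0 <= rho x)%R.
Hypothesis rho_convex : convex_function [set: R] rho.
Hypothesis Wi : P.-integrable setT (EFin \o W).
Hypothesis Zn : standard_normal Z.
Hypothesis WZ : independent_RV W Z.
Variables tau lambda : R.
Hypotheses (tau0 : (0 < tau)%R) (lambda0 : (0 < lambda)%R).

(** G stands for E[q'(X)] and A for E[q(X)^2], where X = W + tau Z and q is the
    residual of the proximal operator; A is an extended real, which each of the
    three systems forces to be finite. *)
Definition state_moments (G : R) (A : \bar R) :=
  [/\ 0 <= A,
      'E_P[fun w => (dprox_dx rho (W w + tau * Z w) lambda)%R] = (1 - G)%:E /\
      'E_P[fun w => ((W w + tau * Z w
                   - prox rho (W w + tau * Z w) lambda) ^+ 2)%R] = A,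
      'E_P[fun w => ((dmoreau_dx rho (W w + tau * Z w) lambda) ^+ 2)%R] =
         (lambda ^- 2)%:E * A /\
      'E_P[fun w => (d2moreau_dx2 rho (W w + tau * Z w) lambda)%R] =
         (G / lambda)%:E,
      'E_P[fun w => (dmoreau_dt rho (W w + tau * Z w) lambda)%R] =
         - (((2 * lambda ^+ 2)^-1)%:E * A) &
      'E_P[fun w => (Z w * dmoreau_dx rho (W w + tau * Z w) lambda)%R] =
         (tau * G / lambda)%:E].

Lemma state_moments_exist : exists G A, state_moments G A.
Proof.
pose q x := (x - prox rho x lambda)%R.
pose X x := (W x + tau * Z x)%R.
have q01 : slopes01 q.
  by apply: slopes01C; exact: slopes01_prox.
have dxE y : (dmoreau_dx rho y lambda = q y / lambda)%R.
  rewrite /dmoreau_dx derive1E.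
  by have [_ ->] := is_derive_moreau_dx rho_convex rho_ge0 lambda0 y.
have dtE y : (dmoreau_dt rho y lambda = - (q y ^+ 2 / (2 * lambda ^+ 2)))%R.
  rewrite /dmoreau_dt derive1E.
  by have [_ ->] := is_derive_moreau_dt rho_convex rho_ge0 y lambda0.
have mq : measurable_fun setT q.
  by apply: continuous_measurable_fun; exact: slopes01_continuous.
have mX : measurable_fun setT X.
  by apply: measurable_funD => //; exact: measurable_funM.
have mqX : measurable_fun setT (fun x => q (X x)) by exact: (measurableT_comp mq).
have mq2 : measurable_fun setT (fun x => (q (X x) ^+ 2)%:E).
  by apply/measurable_EFinP; exact: measurable_funX.
have q20 x : 0 <= (q (X x) ^+ 2)%:E by rewrite lee_fin sqr_ge0.
have [g [mg g01 [N [mN N0 gN]] gE]] := slopes01_density q01.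
have gX0 x : 0 <= (g (X x))%:E by rewrite lee_fin; have /andP[] := g01 (X x).
have mgX : measurable_fun setT (fun x => (g (X x))%:E).
  by apply/measurable_EFinP; exact: (measurableT_comp mg).
have gd y : ~ N y -> is_derive y 1%R q (g y).
  by move=> Ny; apply: contrapT => nd; apply: Ny; apply: gN.
have mN' : measurable (N : set R) by [].
have XN0 := noisy_null Zn WZ tau0 mN' N0.
have mXN : measurable [set x | N (X x)].
  by rewrite -[X in measurable X]setTI; exact: mX.
have gi : P.-integrable setT (fun x => (g (X x))%:E).
  apply: (le_integrable measurableT (g := cst 1%:E)) => //.
  - move=> x _; rewrite /= lee_fin ger0_norm ?normr1; have /andP[] := g01 (X x); lra.
  - exact: finite_measure_integrable_cst.
have Gfin : \int[P]_x (g (X x))%:E \is a fin_num by exact: integrable_fin_num.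
exists (fine (\int[P]_x (g (X x))%:E)), (\int[P]_x (q (X x) ^+ 2)%:E).
split; rewrite ?unlock.
- exact: integral_ge0.
- split=> //.
  rewrite (integral_off_null mXN XN0 (g := fun x => 1 - (g (X x))%:E)).
    rewrite integralB//; last exact: finite_measure_integrable_cst.
    by rewrite integral_cst//= mul1e probability_setT EFinB fineK.
  move=> x /gd [dq qE]; rewrite -EFinB /dprox_dx derive1E; congr _%:E.
  rewrite (_ : (fun y => _) = id - q)%R; last first.
    apply/funext => y; change (prox rho y lambda = y - (y - prox rho y lambda))%R.
    by ring.
  by rewrite deriveB// derive_id qE.
- split.
    rewrite -ge0_integralZl_EFin//; last by rewrite invr_ge0 exprn_ge0// ltW.
    apply: eq_integral => x _; rewrite -EFinM dxE -/(X x) /q; congr _%:E.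
    by rewrite expr_div_n mulrC.
  rewrite (integral_off_null mXN XN0 (g := fun x => (lambda^-1)%:E * (g (X x))%:E)).
    by rewrite ge0_integralZl_EFin ?invr_ge0 ?ltW// mulrC EFinM fineK.
  move=> x /gd [dq qE]; rewrite -EFinM /d2moreau_dx2 derive1E; congr _%:E.
  rewrite (_ : (fun y => _) = lambda^-1 \*: q)%R; last first.
    by apply/funext => y /=; rewrite dxE mulrC.
  by rewrite deriveZ// qE.
- rewrite -ge0_integralZl_EFin//; last first.
    by rewrite invr_ge0 mulr_ge0 ?exprn_ge0// ltW.
  rewrite -integral_ge0N; last first.
    by move=> x _; rewrite -EFinM lee_fin mulr_ge0 ?sqr_ge0// invr_ge0 mulr_ge0 ?exprn_ge0// ltW.
  apply: eq_integral => x _; rewrite dtE -/(X x) EFinN -EFinM mulrC //.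
- have [Zqi ZqE] := stein Zn WZ tau0 Wi q01 mg g01 gE.
  transitivity (\int[P]_x ((lambda^-1)%:E * (Z x * q (X x))%:E)).
    by apply: eq_integral => x _; rewrite dxE -EFinM mulrA mulrC.
  rewrite integralZl// ZqE -[X in _ * (_ * X)]fineK// -!EFinM.
  by congr _%:E; rewrite mulrC.
Qed.

End moments.

Section algebra.
Local Open Scope ereal_scope.
Context d (T : measurableType d) (R : realType) (P : probability T R).
Variables (rho : R -> R) (W Z : {RV P >-> R}) (kappa : R).
Hypothesis kappa0 : (0 < kappa)%R.

Lemma LOO_iff tau lambda G A : state_moments rho W Z tau lambda G A ->
  LOO P rho kappa W Z tau lambda <-> G = kappa /\ A = (kappa * tau ^+ 2)%:E.
Proof.
move=> [_ [E1 E2] _ _ _]; rewrite /LOO E1 E2.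
split=> [[[kG] <-]|[-> ->]] //; split => //; lra.
Qed.

Lemma AMP_iff tau lambda G A : (0 < lambda)%R ->
  state_moments rho W Z tau lambda G A ->
  AMP P rho kappa W Z tau lambda <-> G = kappa /\ A = (kappa * tau ^+ 2)%:E.
Proof.
move=> l0 [A0 _ [E1 E2] _ _]; rewrite /AMP E1 E2.
have ln0 : lambda != 0%R by rewrite gt_eqF.
have kn0 : kappa != 0%R by rewrite gt_eqF.
have -> : (kappa^-1 * lambda ^+ 2)%:E * ((lambda ^- 2)%:E * A) = (kappa^-1)%:E * A.
  by rewrite muleA -EFinM mulfK// expf_neq0.
rewrite -EFinM mulrCA divff// mulr1.
split=> [[tA [<-]]|[-> ->]]; last by rewrite -EFinM mulKf.
by split => //; rewrite EFinM tA muleA -EFinM divff// mul1e.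
Qed.

(** The third equation says A = alpha^2; the first then determines alpha and the
    second determines G. *)
Lemma CGMT_iff tau alpha mu G A : (0 < tau)%R -> (0 < alpha)%R -> (0 < mu)%R ->
  state_moments rho W Z tau (alpha / mu) G A ->
  CGMT P rho kappa W Z tau alpha mu <->
  [/\ alpha = (tau * Num.sqrt kappa)%R, G = kappa & A = (kappa * tau ^+ 2)%:E].
Proof.
move=> t0 a0 m0 [A0 _ _ E1 E2]; rewrite /CGMT E1 E2.
have tn0 : tau != 0%R by rewrite gt_eqF.
have an0 : alpha != 0%R by rewrite gt_eqF.
have mn0 : mu != 0%R by rewrite gt_eqF.
have [s kE] : exists s, s = Num.sqrt kappa by exists (Num.sqrt kappa).
have s0 : (0 < s)%R by rewrite kE sqrtr_gt0.
have sE : (s ^+ 2 = kappa)%R by rewrite kE sqr_sqrtr// ltW.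
rewrite -kE.
case: A A0 {E1 E2} => [a| |//] A0; last first.
  have c0 : (0 : \bar R) < ((2 * (alpha / mu) ^+ 2)^-1)%:E.
    by rewrite lte_fin invr_gt0 mulr_gt0// exprn_gt0// divr_gt0.
  have mV0 : (0 : \bar R) < (mu^-1)%:E by rewrite lte_fin invr_gt0.
  by split=> [[_ _]|[]//]; rewrite (gt0_muley c0) muleN (gt0_muley mV0).
split=> [[[H1] [H2] [H3]]|[aE -> [->]]]; last first.
  by split; congr _%:E; rewrite aE -sE; field; rewrite ?mn0 ?tn0 ?gt_eqF.
have aE : (a = alpha ^+ 2)%R.
  have : (mu / (2 * alpha ^+ 2) * (alpha ^+ 2 - a) = 0)%R.
    by rewrite [RHS]H3; field; rewrite an0 mn0.
  move/eqP; rewrite mulf_eq0 gt_eqF/= ?divr_gt0 ?mulr_gt0 ?exprn_gt0//.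
  by rewrite subr_eq0 => /eqP.
have alE : (alpha = tau * s)%R.
  apply/eqP; rewrite -subr_eq0 [X in _ == X]H1 aE; apply/eqP.
  by field; rewrite an0 mn0.
split => //.
- have : (mu / s * (G - s ^+ 2) = 0)%R.
    by rewrite [RHS]H2 alE; field; rewrite tn0 mn0 gt_eqF.
  move/eqP; rewrite mulf_eq0 gt_eqF/= ?divr_gt0// subr_eq0 => /eqP ->.
  exact: sE.
by rewrite aE alE -sE; congr _%:E; ring.
Qed.

End algebra.

Unset Implicit Arguments.

Theorem theorem1 (R : realType) (d : measure_display) (T : measurableType d)
  (P : probability T R) (rho : R -> R) (kappa sigma : R) (W Z : {RV P >-> R})
  (rho_ge0 : forall x, 0 <= rho x)
  (rho_convex : convex_function [set: R] rho)
  (kappa01 : 0 < kappa < 1)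
  (W_mean : ('E_P[W] = 0)%E)
  (W_var : ('V_P[W] = (sigma ^+ 2)%:E)%E)
  (Z_normal : standard_normal Z)
  (WZ_indep : independent_RV W Z) :
  (forall tau lambda : R, 0 < tau -> 0 < lambda ->
     AMP P rho kappa W Z tau lambda <-> LOO P rho kappa W Z tau lambda) /\
  (forall tau2 lambda2 : R, 0 < tau2 -> 0 < lambda2 ->
     AMP P rho kappa W Z tau2 lambda2 <->
     exists tau3 alpha mu : R,
       [/\ [/\ 0 < tau3, 0 < alpha & 0 < mu],
           CGMT P rho kappa W Z tau3 alpha mu,
           tau2 = tau3 & lambda2 = alpha / mu]) /\
  (forall tau3 alpha mu : R, 0 < tau3 -> 0 < alpha -> 0 < mu ->
     CGMT P rho kappa W Z tau3 alpha mu ->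
     AMP P rho kappa W Z tau3 (alpha / mu)).
Proof.
have k0 : 0 < kappa by case/andP: kappa01.
have Wi : P.-integrable setT (EFin \o W).
  apply/integrableP; split; first exact/measurable_EFinP.
  rewrite integral_fin_num_abs//.
  by move: W_mean; rewrite unlock => ->.
have moments := state_moments_exist rho_ge0 rho_convex Wi Z_normal WZ_indep.
have CGMT_AMP t a m : 0 < t -> 0 < a -> 0 < m ->
    CGMT P rho kappa W Z t a m -> AMP P rho kappa W Z t (a / m).
  move=> t0 a0 m0; have am0 : 0 < a / m by rewrite divr_gt0.
  have [G [A GA]] := moments _ _ t0 am0.
  by move=> /(CGMT_iff k0 t0 a0 m0 GA)[_ GE AE]; apply/(AMP_iff k0 am0 GA).
split; [|split] => //.
- move=> tau lambda t0 l0.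
  have [G [A GA]] := moments _ _ t0 l0.
  by rewrite (AMP_iff k0 l0 GA) (LOO_iff _ GA).
- move=> tau lambda t0 l0; split; last first.
    by move=> [t [a [m [[? ? ?] ? -> ->]]]]; exact: CGMT_AMP.
  have [G [A GA]] := moments _ _ t0 l0.
  move=> /(AMP_iff k0 l0 GA)[GE AE].
  have a0 : 0 < tau * Num.sqrt kappa by rewrite mulr_gt0 ?sqrtr_gt0.
  have m0 : 0 < tau * Num.sqrt kappa / lambda by rewrite divr_gt0.
  have lE : lambda = tau * Num.sqrt kappa / (tau * Num.sqrt kappa / lambda).
    by field; rewrite ?gt_eqF ?sqrtr_gt0.
  exists tau, (tau * Num.sqrt kappa), (tau * Num.sqrt kappa / lambda).
  split => //; rewrite lE in GA; apply/(CGMT_iff k0 t0 a0 m0 GA); split => //.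
Qed.
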